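(* Let $(\Omega,\Sigma,\nu)$ be a complete probability space, let $X$ be a Banach space and let $\Gamma\subseteq X^*$ be a total linear subspace. Let $f:\Omega\to X$ be a $\Gamma$-scalarly integrable function such that the family $\{\langle x^*,f\rangle: x^*\in\Gamma\cap B_{X^*}\}$ is uniformly integrable. (i) If $(\Gamma,w^* )$ has the Mazur property, then $f$ is $\Gamma$-integrable. (ii) If $X$ has property $(\mathcal{E}')$ and $\Gamma$ is norming, then $f$ is Pettis integrable.
   Context: All Banach spaces are real; $B_{X^*}$ is the closed unit ball of $X^*$; $w^*$ is the weak$^*$ topology on $X^*$, and $(\Gamma,w^* )$ is $\Gamma$ with the topology inherited from $(X^*,w^* )$. Linear subspaces need not be closed. A set $\Gamma\subseteq X^*$ is total if for every $x\in X\setminus\{0\}$ there is $x^*\in\Gamma$ with $x^*(x)\neq 0$. A linear subspace $\Gamma\subseteq X^*$ is norming if $|||x|||=\sup\{x^*(x):x^*\in\Gamma\cap B_{X^*}\}$ defines an equivalent norm on $X$. A function $f:\Omega\to X$ is $\Gamma$-scalarly integrable if $\langle x^*,f\rangle:\omega\mapsto x^*(f(\omega))$ is $\nu$-integrable for every $x^*\in\Gamma$. It is $\Gamma$-integrable if, in addition, for every $A\in\Sigma$ there is $\int_A f\,d\nu\in X$ such that $x^*(\int_A f\,d\nu)=\int_A\langle x^*,f\rangle\,d\nu$ for all $x^*\in\Gamma$. Pettis integrability is $\Gamma$-integrability for $\Gamma=X^*$. A set $H\subseteq L_1(\nu)$ is uniformly integrable if it is bounded in $L_1(\nu)$ and for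 every $\varepsilon>0$ there is $\delta>0$ such that $\sup_{h\in H}\int_A|h|\,d\nu\le\varepsilon$ for every $A\in\Sigma$ with $\nu(A)\le\delta$. A locally convex Hausdorff space $E$ has the Mazur property if every sequentially continuous linear functional $\varphi:E\to\mathbb{R}$ is continuous. $X$ has property $(\mathcal{E}')$ if every $w^*$-sequentially closed convex bounded subset of $X^*$ is $w^*$-closed. *)

(* Defs.v *)
From HB Require Import structures.
From mathcomp Require Import all_boot all_order all_algebra.
From mathcomp Require Import all_classical all_reals all_analysis.

Set Implicit Arguments.
Unset Strict Implicit.
Unset Printing Implicit Defensive.

Import Order.TTheory GRing.Theory Num.Theory.
Import numFieldNormedType.Exports.

Local Open Scope classical_set_scope.
Local Open Scope ring_scope.

Section dual_space.
Context {R : realType} {X : normedModType R}.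

Definition dual_pred : {pred X -> R^o} :=
  mem [set g : X -> R^o | linear g /\ continuous g].

Lemma dual_submod_closed : submod_closed dual_pred.
Proof.
split.
  rewrite inE; split; first by move=> a u v; rewrite scaler0 addr0.
  by move=> x; exact: cvg_cst.
move=> a u v; rewrite !inE => -[lu cu] [lv cv]; split.
  move=> b x y; rewrite !fctE lu lv !scalerDr !scalerA (mulrC a).
  by rewrite addrACA.
move=> x; apply: (@cvgD _ _ _ _ _ (a \*: u) v); last exact: cv.
by apply: cvgZl_tmp; exact: cu.
Qed.

HB.instance Definition _ :=
  GRing.isSubmodClosed.Build R (X -> R^o) dual_pred dual_submod_closed.

End dual_space.

Record dual (R : realType) (X : normedModType R) := Dual {
  dual_fun :> X -> R^o ;
  _ : dual_fun \in @dual_pred R X }.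

HB.instance Definition _ (R : realType) (X : normedModType R) :=
  [isSub for @dual_fun R X].
HB.instance Definition _ (R : realType) (X : normedModType R) :=
  [Choice of dual X by <:].
HB.instance Definition _ (R : realType) (X : normedModType R) :=
  [SubChoice_isSubLmodule of dual X by <:].

(* The topology carried by [dual X] is the weak* topology, not the topology of
   the norm [dual_norm]. *)
HB.instance Definition _ (R : realType) (X : normedModType R) :=
  Topological.copy (dual X)
    (initial_topology (@dual_fun R X : dual X -> {ptws X -> R^o})).

Section banach.
Context {R : realType} {X : normedModType R}.

Definition dual_norm (g : dual X) : R :=
  sup [set `|g x| | x in [set x : X | `|x| <= 1]].

Definition dual_ball : set (dual X) := [set g | dual_norm g <= 1].

Definition total_set (G : set (dual X)) : Prop :=
  forall x : X, x != 0 -> exists2 g, G g & g x != 0.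

Definition is_norm (N : X -> R) : Prop :=
  [/\ forall x y, N (x + y) <= N x + N y,
      forall (a : R) x, N (a *: x) = `|a| * N x
    & forall x, N x = 0 -> x = 0].

Definition equivalent_norm (N : X -> R) : Prop :=
  is_norm N /\
  exists c C : R, [/\ 0 < c, 0 < C & forall x, c * `|x| <= N x <= C * `|x|].

Definition norming (G : set (dual X)) : Prop :=
  equivalent_norm (fun x => sup [set (g x : R) | g in G `&` dual_ball]).

End banach.

(* The Mazur property of the linear subspace [G] of [E] with the topology
   inherited from [E]; the values of [phi] outside [G] play no role. *)
Definition mazur_property (R : realType) (E : preTopologicalLmodType R)
    (G : set E) : Prop :=
  forall phi : E -> R^o,
    (forall a : R, {in G &, forall u v, phi (a *: u + v) = a *: phi u + phi v}) ->
    (forall (u : nat -> E) (l : E), (forall n, G (u n)) -> G l ->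
      u @ \oo --> l -> phi (u n) @[n --> \oo] --> phi l) ->
    {within G, continuous phi}.

Definition seq_closed (E : topologicalType) (C : set E) : Prop :=
  forall (u : nat -> E) (l : E), (forall n, C (u n)) -> u @ \oo --> l -> C l.

Definition property_E' (R : realType) (X : normedModType R) : Prop :=
  forall C : set (dual X),
    seq_closed C -> convex_set C ->
    (exists M : R, forall g, C g -> dual_norm g <= M) ->
    closed C.

Section integration.
Context {d : measure_display} {T : measurableType d} {R : realType}.
Variable nu : probability T R.

Definition uniformly_integrable (H : set (T -> R)) : Prop :=
  [/\ forall h, H h -> nu.-integrable setT (EFin \o h),
      exists M : R, forall h, H h -> (\int[nu]_w `|h w|%:E <= M%:E)%E
    & forall e : R, 0 < e -> exists2 delta : R, 0 < delta &
        forall A, measurable A -> (nu A <= delta%:E)%E ->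
          (ereal_sup [set \int[nu]_(w in A) `|h w|%:E | h in H] <= e%:E)%E].

Context {X : normedModType R}.

Definition scalarly_integrable (G : set (dual X)) (f : T -> X) : Prop :=
  forall g, G g -> nu.-integrable setT (fun w => (g (f w))%:E).

Definition gamma_integrable (G : set (dual X)) (f : T -> X) : Prop :=
  scalarly_integrable G f /\
  forall A, measurable A -> exists x : X,
    forall g, G g -> ((g x)%:E = \int[nu]_(w in A) (g (f w))%:E)%E.

Definition pettis_integrable (f : T -> X) : Prop := gamma_integrable setT f.

End integration.

(* Main.v *)
(* For measurable A put phi_A g = int_A g o f. A weak*-convergent sequence of
   functionals is bounded (Banach-Steinhaus), so phi_A is sequentially continuous
   on G by Vitali's theorem; the Mazur property makes it weak*-continuous, hence
   an evaluation, which is (i).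

   For (ii), the g in the unit ball whose compositions g o f obey the integral
   bounds of the family over G form a convex, sequentially closed set. By (E') it
   is weak*-closed, so by the bipolar theorem it contains a multiple of the unit
   ball, since G is norming. Hence phi_A is defined and sequentially continuous
   on all of the dual. By (E') again the sets {phi_A >= e} are weak*-closed in
   the ball, so phi_A is uniformly approximated on the ball by evaluations at
   points of X; these are Cauchy because G is norming, and converge. *)
From HB Require Import structures.
Require Import Defs.
From mathcomp Require Import all_boot all_order all_algebra.
From mathcomp Require Import all_classical all_reals all_analysis.
From mathcomp Require Import measurable_realfun ring lra.
Set Implicit Arguments.
Unset Strict Implicit.
Unset Printing Implicit Defensive.

Import Order.TTheory GRing.Theory Num.Theory.
Import numFieldNormedType.Exports.
Local Open Scope classical_set_scope.
Local Open Scope ring_scope.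

(** * Evaluation, norm and weak* topology of the dual *)

Section dual_space.
Context {R : realType} {X : normedModType R}.
Implicit Types (g h : dual X) (x y : X).

Lemma dual_linear_continuous g : linear (g : X -> R^o) /\ continuous (g : X -> R^o).
Proof. by case: g => g /=; rewrite inE. Qed.

(* The casts to R select the operations of R rather than those of R^o, which
   the ring tactics do not recognize. *)
Lemma dualP g a x y : g (a *: x + y) = a * (g x : R) + (g y : R).
Proof. by have [+ _] := dual_linear_continuous g; apply. Qed.

Lemma dual_apply0 g : g 0 = 0.
Proof. by have := dualP g (-1) 0 0; rewrite scaler0 add0r mulN1r addNr. Qed.

Lemma dual_applyZ g a x : g (a *: x) = a * (g x : R).
Proof. by rewrite -[a *: x]addr0 dualP dual_apply0 addr0. Qed.

Lemma dual_applyD g x y : g (x + y) = (g x : R) + (g y : R).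
Proof. by rewrite -[x]scale1r dualP mul1r scale1r. Qed.

Lemma dual_applyN g x : g (- x) = - (g x : R).
Proof. by rewrite -scaleN1r dual_applyZ mulN1r. Qed.

Lemma dual_applyB g x y : g (x - y) = (g x : R) - (g y : R).
Proof. by rewrite dual_applyD dual_applyN. Qed.

Lemma dual_apply_sum g (I : finType) (F : I -> X) :
  g (\sum_i F i) = \sum_i (g (F i) : R).
Proof.
elim/big_rec2 : _ => [|i u v _ <-]; first exact: dual_apply0.
exact: dual_applyD.
Qed.

Lemma dual_funP a g h x : (a *: g + h) x = a * (g x : R) + (h x : R).
Proof. by []. Qed.

Lemma dual_funZ a g x : (a *: g) x = a * (g x : R).
Proof. by []. Qed.

Lemma dual_fun0 x : (0 : dual X) x = 0.
Proof. by []. Qed.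

Lemma dual_norm_has_sup g :
  has_sup [set `|g x| | x in [set x : X | `|x| <= 1]].
Proof.
split; first by exists `|g 0|, 0 => //=; rewrite normr0 ler01.
have [lg cg] := dual_linear_continuous g.
pose G : {linear X -> R^o} := HB.pack (g : X -> R^o) (GRing.isLinear.Build _ _ _ _ _ lg).
have /linear_boundedP/pinfty_ex_gt0[M M0 gM] : bounded_near G (nbhs 0).
  by apply/linear_bounded_continuous.
exists M => _ [x /= x1 <-]; apply: (le_trans (gM x)).
by rewrite ler_piMr// ltW.
Qed.

Lemma dual_norm_ge0 g : 0 <= dual_norm g.
Proof.
apply: ub_le_sup; first exact: (dual_norm_has_sup g).2.
by exists 0; rewrite /= ?normr0 ?ler01// dual_apply0 normr0.
Qed.

Lemma ler_dual_norm g x : `|g x| <= dual_norm g * `|x|.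
Proof.
have [->|x0] := eqVneq x 0; first by rewrite dual_apply0 !normr0 mulr0.
rewrite -ler_pdivrMr ?normr_gt0// mulrC -[X in X * _]ger0_norm ?invr_ge0//.
rewrite -normrM -dual_applyZ; apply: ub_le_sup.
  exact: (dual_norm_has_sup g).2.
exists (`|x|^-1 *: x) => //=.
by rewrite normrZ normfV normr_id mulVf// normr_eq0.
Qed.

Lemma dual_norm_leP g (M : R) : 0 <= M ->
  dual_norm g <= M <-> forall x, `|g x| <= M * `|x|.
Proof.
move=> M0; split=> [gM x|gM].
  by rewrite (le_trans (ler_dual_norm g x))// ler_wpM2r.
apply: ge_sup; first exact: (dual_norm_has_sup g).1.
move=> _ [x /= x1 <-]; apply: (le_trans (gM x)).
by rewrite ler_piMr.
Qed.

Lemma dual_ballP g : dual_ball g <-> forall x, `|g x| <= `|x|.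
Proof.
rewrite /dual_ball /= dual_norm_leP ?ler01//.
by split=> gM x; have := gM x; rewrite mul1r.
Qed.

Lemma dual_normZ a g : dual_norm (a *: g) <= `|a| * dual_norm g.
Proof.
apply/dual_norm_leP; first by rewrite mulr_ge0// dual_norm_ge0.
by move=> x; rewrite dual_funZ normrM -mulrA ler_wpM2l// ler_dual_norm.
Qed.

Lemma dual_ball_line g h (t : R) : dual_ball g -> dual_ball h -> 0 <= t <= 1 ->
  dual_ball (t *: g + (1 - t) *: h).
Proof.
move=> /dual_ballP g1 /dual_ballP h1 /andP[t0 t1]; apply/dual_ballP => x.
rewrite dual_funP dual_funZ (le_trans (ler_normD _ _))// !normrM (ger0_norm t0)
  [`|1 - t|]ger0_norm ?subr_ge0//.
have := ler_wpM2l t0 (g1 x); have : 0 <= 1 - t by rewrite subr_ge0.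
move=> /ler_wpM2l/(_ _ _ (h1 x)); lra.
Qed.

Lemma convex_set_line (C : set (dual X)) :
  (forall g h (t : R), C g -> C h -> 0 <= t <= 1 -> C (t *: g + (1 - t) *: h)) ->
  convex_set C.
Proof.
move=> Cl g h t; rewrite !inE => Cg Ch; apply: (Cl g h t%:num Cg Ch).
by apply/andP; split.
Qed.

(** The topology is the initial one for the inclusion into a product of copies of [R], so
    convergence can be tested pointwise. *)
Lemma dual_cvgP (F : set_system (dual X)) g : Filter F ->
  F --> g <-> forall x, ((fun h : dual X => h x : R^o) @ F) --> (g x : R^o).
Proof.
move=> FF; split=> [Fg x|Fg].
  have : (dual_fun h : {ptws X -> R^o}) @[h --> F] --> (dual_fun g : {ptws X -> R^o}).
    apply: cvg_trans (@initial_continuous _ _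
      (@dual_fun R X : dual X -> {ptws X -> R^o}) g).
    exact: cvg_app.
  by move=> /(@pointwise_cvgP _ _ _ _ (fmap_filter _ FF))/(_ x).
have : (dual_fun h : {ptws X -> R^o}) @[h --> F] --> (dual_fun g : {ptws X -> R^o}).
  by apply/(@pointwise_cvgP _ _ _ _ (fmap_filter _ FF)) => x; exact: Fg.
move=> Fg' A /= [_ [[B oB <-] Bg BA]].
apply: filterS BA _; apply: (Fg' B); exact: open_nbhs_nbhs.
Qed.

Lemma dual_cvgnP (u : nat -> dual X) g :
  u @ \oo --> g <-> forall x, (u n x : R^o) @[n --> \oo] --> (g x : R^o).
Proof. exact: dual_cvgP. Qed.

(** The sets containing some [B s e] form a filter; it converges to [g] pointwise, hence weak*, and
    so contains every neighbourhood of [g]. *)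
Lemma dual_nbhs g (U : set (dual X)) : nbhs g U ->
  exists (s : seq X) (e : R), 0 < e /\
    forall h, (forall i : 'I_(size s), `|h s`_i - g s`_i| < e) -> U h.
Proof.
pose B (s : seq X) (e : R) : set (dual X) :=
  [set h | forall x, x \in s -> `|h x - g x| < e].
pose F : set_system (dual X) := [set A | exists s e, 0 < e /\ B s e `<=` A].
have FF : Filter F.
  split.
  - by exists [::], 1.
  - move=> P Q [s [e [e0 sP]]] [s' [e' [e'0 sQ]]].
    exists (s ++ s'), (Num.min e e'); split; first by rewrite lt_min e0.
    move=> h hB; split; [apply: sP|apply: sQ] => x xs.
      have := hB x; rewrite mem_cat xs lt_min => /(_ isT)/andP[]//.
    by have := hB x; rewrite mem_cat xs orbT lt_min => /(_ isT)/andP[].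
  - by move=> P Q PQ [s [e [e0 sP]]]; exists s, e; split=> //; exact: subset_trans PQ.
have Fg : F --> g.
  apply/dual_cvgP => x; apply/cvgrPdist_lt => e e0.
  exists [:: x], e; split=> // h /(_ x); rewrite mem_head => /(_ isT) /=.
  by rewrite distrC.
move=> /Fg[s [e [e0 BU]]]; exists s, e; split=> // h hs; apply: BU => x xs.
have xs' : (index x s < size s)%N by rewrite index_mem.
by have := hs (Ordinal xs'); rewrite /= nth_index.
Qed.

Lemma dual_ball_seq_closed : seq_closed (@dual_ball R X).
Proof.
move=> u l ub /dual_cvgnP ul; apply/dual_ballP => x.
apply: (cvgr_to_le (cvg_norm (ul x))).
by apply: nearW => n; have /dual_ballP := ub n; exact.
Qed.

End dual_space.

(** * Separation from the origin in finite dimension *)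

Section separation.
Context {R : realType} {I : finType}.
Implicit Types (u v a : I -> R).

(* A convex bounded set C is separated from 0 by a point of C of almost minimal
   Euclidean norm, so C need not be closed. *)
Lemma separate_from_origin (C : set (I -> R)) (M e : R) :
  (forall u v (t : R), C u -> C v -> 0 <= t <= 1 ->
     C (fun i => t * u i + (1 - t) * v i)) ->
  (forall u i, C u -> `|u i| <= M) ->
  0 < e -> (forall u, C u -> exists i, e <= `|u i|) ->
  exists a, exists2 delta : R, 0 < delta &
    forall u, C u -> delta <= \sum_i a i * u i.
Proof.
move=> Cconv CM e0 Ce.
have [C0|/set0P[u0 Cu0]] := eqVneq C set0.
  by exists (fun=> 0), 1 => // u; rewrite C0.
pose q u := \sum_i u i ^+ 2.
have qe u : C u -> e ^+ 2 <= q u.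
  move=> /Ce[i ei]; rewrite /q (bigD1 i)//=.
  rewrite -[leLHS]addr0 lerD ?sumr_ge0// => [|j _]; last exact: sqr_ge0.
  by rewrite -[leRHS]real_normK ?num_real// ler_sqr ?nnegrE// ltW.
pose K : R := \sum_(i : I) (2 * M) ^+ 2.
have K0 : 0 <= K by rewrite sumr_ge0// => i _; exact: sqr_ge0.
have qK u v : C u -> C v -> q (fun i => u i - v i) <= K.
  move=> Cu Cv; apply: ler_sum => i _.
  rewrite -[leLHS]real_normK ?num_real// ler_sqr ?nnegrE//; last first.
    by rewrite mulr_ge0// (le_trans _ (CM _ i Cu)).
  rewrite (le_trans (ler_normB _ _))//.
  by have := CM _ i Cu; have := CM _ i Cv; lra.
(* With this [t], the second-order term, at most [t ^+ 2 * K], and the error [t ^+ 2] of the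
   near-minimum below add up to at most [t * e ^+ 2]. *)
pose t := Num.min 1 (e ^+ 2 / (1 + K)).
have K1 : 0 < 1 + K by rewrite ltr_wpDr.
have t0 : 0 < t by rewrite lt_min ltr01 divr_gt0// exprn_gt0.
have t1 : t <= 1 by rewrite ge_min lexx.
have te : t * (1 + K) <= e ^+ 2 by rewrite -ler_pdivlMr// ge_min lexx orbT.
have qi : has_inf [set q u | u in C].
  by split; [exists (q u0), u0|exists (e ^+ 2) => _ [u Cu <-]; exact: qe].
have [_ [y Cy <-] yt] := inf_adherent (exprn_gt0 2 t0) qi.
exists y, (e ^+ 2 / 2); first by rewrite divr_gt0// exprn_gt0.
move=> z Cz; set s := \sum_i _.
(* Moving from [y] towards [z] cannot lower [q] by more than [t ^+ 2]; expanding [q w] in [t] then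
   bounds [s - q y] below by [- e ^+ 2 / 2]. *)
pose w := fun i => t * z i + (1 - t) * y i.
have Cw : C w by apply: Cconv => //; rewrite ltW.
have qw : inf [set q u | u in C] <= q w.
  by apply: ge_inf; [exact: qi.2|exists w].
have qwE : q w = q y + 2 * t * (s - q y) + t ^+ 2 * q (fun i => z i - y i).
  rewrite /q /s -sumrB !mulr_sumr -!big_split/=; apply: eq_bigr => i _.
  by rewrite /w; ring.
have h1 := qK _ _ Cz Cy; have h2 := qe _ Cy.
have h3 : t ^+ 2 * q (fun i => z i - y i) <= t ^+ 2 * K by rewrite ler_wpM2l// sqr_ge0.
have h4 : 0 <= t * (2 * (s - q y) + t * (1 + K)).
  by rewrite qwE in qw; nra.
move: h4; rewrite pmulr_rge0// => h4; lra.
Qed.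

End separation.

(** * Integrals under a common modulus of absolute continuity *)

Section dominated_integrals.
Context {d : measure_display} {T : measurableType d} {R : realType}.
Variable nu : probability T R.
Implicit Types (beta : set T -> \bar R) (h : T -> R) (A : set T).

(* Uniform integrability of H is domination by beta A = sup_(h in H) int_A |h|;
   unlike H, the set of functions dominated by beta is convex and closed under
   pointwise limits. *)
Definition absolutely_dominated beta h : Prop :=
  measurable_fun setT h /\
  forall A, measurable A -> (\int[nu]_(w in A) `|h w|%:E <= beta A)%E.

Definition uniform_modulus beta : Prop :=
  (beta setT < +oo)%E /\
  forall e : R, 0 < e -> exists2 delta : R, 0 < delta &
    forall A, measurable A -> (nu A <= delta%:E)%E -> (beta A <= e%:E)%E.

Lemma absolutely_dominated_integrable beta h A : uniform_modulus beta ->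
  absolutely_dominated beta h -> measurable A -> nu.-integrable A (EFin \o h).
Proof.
move=> [boo _] [mh hb] mA; apply: (@integrableS _ _ _ _ setT) => //.
apply/integrableP; split; first exact/measurable_EFinP.
exact: le_lt_trans (hb setT measurableT) boo.
Qed.

Lemma absolutely_dominated_Rintegral_le beta h A (e : R) : uniform_modulus beta ->
  absolutely_dominated beta h -> measurable A -> (beta A <= e%:E)%E ->
  \int[nu]_(w in A) `|h w| <= e.
Proof.
move=> mb hb mA Ae; rewrite -lee_fin fineK; last first.
  apply: integrable_fin_num => //.
  apply: integrable_norm; exact: absolutely_dominated_integrable hb mA.
exact: le_trans (hb.2 A mA) Ae.
Qed.

Lemma absolutely_dominated_convex beta h k (t : R) :
  absolutely_dominated beta h -> absolutely_dominated beta k -> 0 <= t <= 1 ->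
  absolutely_dominated beta (fun w => t * h w + (1 - t) * k w).
Proof.
move=> [mh hb] [mk kb] /andP[t0 t1]; have t1' : 0 <= 1 - t by rewrite subr_ge0.
have mhk : measurable_fun setT (fun w => t * h w + (1 - t) * k w).
  by apply: measurable_funD; apply: measurable_funM.
split=> // A mA.
have mnorm (g : T -> R) : measurable_fun setT g -> measurable_fun A (fun w => `|g w|%:E).
  move=> mg; apply: (measurable_funS measurableT) => //.
  by apply/measurable_EFinP; exact: measurableT_comp.
(* Distributivity holds for nonnegative coefficients even when [beta A] is infinite. *)
have -> : beta A = (t%:E * beta A + (1 - t)%:E * beta A)%E.
  rewrite -ge0_muleDl ?lee_fin//.
  by rewrite -EFinD addrC subrK mul1e.
have /le_trans : (\int[nu]_(w in A) `|t * h w + (1 - t) * k w|%:E <=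
   \int[nu]_(w in A) (t%:E * `|h w|%:E + (1 - t)%:E * `|k w|%:E))%E.
  apply: ge0_le_integral => //.
  - exact: mnorm.
  - by apply: emeasurable_funD; apply: measurable_funeM; exact: mnorm.
  - move=> w _; rewrite -!EFinM -EFinD lee_fin (le_trans (ler_normD _ _))//.
    by rewrite !normrM (ger0_norm t0) (ger0_norm t1').
apply; rewrite ge0_integralD//; first last.
- by apply: measurable_funeM; exact: mnorm.
- by move=> w _; rewrite mule_ge0// lee_fin.
- by apply: measurable_funeM; exact: mnorm.
- by move=> w _; rewrite mule_ge0// lee_fin.
rewrite !ge0_integralZl_EFin//; [|exact: mnorm|exact: mnorm].
by apply: leeD; apply: lee_wpmul2l; rewrite ?lee_fin//; [exact: hb|exact: kb].
Qed.

(** Fatou's lemma bounds the integral of the absolute value of [h] by a limit inferior of integrals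
    that are all at most [beta A]. *)
Lemma absolutely_dominated_cvg beta (h_ : nat -> T -> R) h :
  (forall n, absolutely_dominated beta (h_ n)) ->
  (forall w, h_ n w @[n --> \oo] --> h w) -> absolutely_dominated beta h.
Proof.
move=> hb hh.
have mh : measurable_fun setT h.
  apply: (@measurable_fun_cvg _ _ _ _ h_) => // n; exact: (hb n).1.
split=> // A mA.
rewrite (eq_integral (fun w => limn_einf (fun n => `|h_ n w|%:E))); last first.
  move=> w _.
  suff -> : limn_einf (fun n => `|h_ n w|%:E) = `|h w|%:E by [].
  have /cvg_limn_einf_sup[//] : `|h_ n w|%:E @[n --> \oo] --> `|h w|%:E.
  by apply/cvg_EFin; [exact: nearW|exact: cvg_norm].
apply: (le_trans (fatou _ mA _ _)) => //.
  move=> n; apply: (measurable_funS measurableT) => //.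
  apply/measurable_EFinP; apply: measurableT_comp => //; exact: (hb n).1.
rewrite limn_einf_lim; apply: lime_le; first exact: is_cvg_einfs.
apply: nearW => n; apply: le_trans ((hb n).2 A mA).
by apply: ereal_inf_lbound; exists n => /=.
Qed.

(* Vitali's convergence theorem, from Egorov's. *)
Lemma absolutely_dominated_cvg_Rintegral beta (h_ : nat -> T -> R) h A :
  uniform_modulus beta ->
  (forall n, absolutely_dominated beta (h_ n)) ->
  (forall w, h_ n w @[n --> \oo] --> h w) -> measurable A ->
  \int[nu]_(w in A) h_ n w @[n --> \oo] --> \int[nu]_(w in A) h w.
Proof.
move=> mb hb hh mA; have hd := absolutely_dominated_cvg hb hh.
have intn (k : T -> R) B : absolutely_dominated beta k -> measurable B ->
    nu.-integrable B (EFin \o (fun w => `|k w|)).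
  move=> kb mB; apply: integrable_norm.
  exact: absolutely_dominated_integrable kb mB.
have int k B : absolutely_dominated beta k -> measurable B ->
    nu.-integrable B (EFin \o k).
  by move=> kb mB; exact: absolutely_dominated_integrable kb mB.
have intB n B : measurable B -> nu.-integrable B (EFin \o (fun w => h_ n w - h w)).
  by move=> mB; exact: (integrableB mB (int _ _ (hb n) mB) (int _ _ hd mB)).
apply/cvgrPdist_le => e e0.
(* One third is for the uniform convergence off the small Egorov set [B], the other two for the
   integrals of [h_ n] and [h] in absolute value over the part of [A] inside [B]. *)
have e3 : 0 < e / 3 by rewrite divr_gt0.
have [delta d0 bd] := mb.2 _ e3.
have [B [mB Bd hB]] : exists B, [/\ measurable B, (nu B < delta%:E)%E &
    {uniform setT `\` B, h_ @ \oo --> h}].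
  apply: pointwise_almost_uniform => //.
  - by move=> n; exact: (hb n).1.
  - by rewrite (le_lt_trans (probability_le1 _ _))// ltry.
have : \forall n \near \oo, forall w, (setT `\` B) w -> `|h w - h_ n w| < e / 3.
  apply: (hB [set k | forall w, (setT `\` B) w -> `|h w - k w| < e / 3]).
  apply/uniform_nbhs; exists [set xy | ball xy.1 (e / 3) xy.2].
  by split; [exact: (entourage_ball R (PosNum e3))|].
apply: filterS => n hn.
have mAB : measurable (A `&` B) by exact: measurableI.
have mADB : measurable (A `\` B) by exact: measurableD.
have bAB : (beta (A `&` B) <= (e / 3)%:E)%E.
  apply: bd => //; apply: le_trans (ltW Bd).
  by apply: le_measure; rewrite ?inE// => w [].
rewrite distrC -RintegralB//; [|exact: int..].
rewrite (le_trans (le_normr_Rintegral _ _))//; first exact: intB.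
rewrite -[in leLHS](setUIDK A B) Rintegral_setU//; last 2 first.
- by rewrite setUIDK; apply: integrable_norm; exact: intB.
- rewrite disj_set2E; apply/eqP; rewrite setIDA; apply/seteqP.
  by split=> // w [[[? ?] ?]].
have : \int[nu]_(w in A `\` B) `|h_ n w - h w| <= e / 3.
  apply: (@le_trans _ _ (\int[nu]_(w in A `\` B) (e / 3))).
    apply: le_Rintegral => //.
    - by apply: integrable_norm; exact: intB.
    - apply: (@integrableS _ _ _ _ setT) => //.
      exact: finite_measure_integrable_cst.
    - by move=> w [Aw Bw]; rewrite distrC ltW// hn.
  rewrite (Rintegral_cst nu mADB) ler_piMr ?(ltW e3)//.
  rewrite -lee_fin fineK ?fin_num_measure//; exact: probability_le1.
have : \int[nu]_(w in A `&` B) `|h_ n w - h w| <=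
    \int[nu]_(w in A `&` B) `|h_ n w| + \int[nu]_(w in A `&` B) `|h w|.
  rewrite -RintegralD//; [|exact: intn..].
  apply: le_Rintegral => //.
  - by apply: integrable_norm; exact: intB.
  - exact: (integrableD mAB (intn _ _ (hb n) mAB) (intn _ _ hd mAB)).
  - by move=> w _; exact: ler_normB.
have := absolutely_dominated_Rintegral_le mb (hb n) mAB bAB.
have := absolutely_dominated_Rintegral_le mb hd mAB bAB.
lra.
Qed.

End dominated_integrals.

(** * Functionals on the dual that are evaluations *)

Section functional_representation.
Context {R : realType}.

Lemma dual_cvgn_bounded (X : completeNormedModType R) (u : nat -> dual X) (l : dual X) :
  u @ \oo --> l -> exists2 K : R, 0 < K & forall n, dual_norm (u n) <= K.
Proof.
move=> /dual_cvgnP ul.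
pose F : set (X -> R^o) := [set dual_fun (u n) | n in setT].
have [|x|M FM] := @Banach_Steinhauss R X R^o F _ _ 1.
- move=> _ [n _ <-]; split; last exact: (dual_linear_continuous (u n)).1.
  move=> r; exists (dual_norm (u n) * r) => x xr.
  by rewrite (le_trans (ler_dual_norm _ _))// ler_wpM2l// dual_norm_ge0.
- have /cvg_seq_bounded/pinfty_ex_gt0[M M0 uM] : cvgn (fun n => u n x : R^o).
    by apply/cvg_ex; exists (l x); exact: ul.
  by exists M => _ [n _ <-]; exact: uM.
exists (Num.max 1 M) => [|n]; first by rewrite lt_max ltr01.
apply: ge_sup; first exact: (dual_norm_has_sup (u n)).1.
move=> _ [x /= x1 <-]; rewrite le_max; apply/orP; right.
by apply: FM => //; exists n.
Qed.

Context {X : normedModType R}.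
Implicit Types (G : set (dual X)) (phi : dual X -> R).

(** Induction on [s]: on the elements of [G] vanishing at the head [y], the tail gives a point [z];
    a multiple of [y] then corrects [z] on one element of [G] not vanishing at [y], if there is
    any. *)
Lemma eval_of_common_kernel (s : seq X) G phi :
  G 0 -> (forall a u v, G u -> G v -> G (a *: u + v)) ->
  (forall a u v, G u -> G v -> phi (a *: u + v) = a * phi u + phi v) ->
  (forall g, G g -> (forall i : 'I_(size s), g s`_i = 0) -> phi g = 0) ->
  exists x, forall g, G g -> phi g = g x.
Proof.
elim: s G => [|y s IHs] G G0 Glin philin phi0.
  by exists 0 => g Gg; rewrite dual_apply0; apply: phi0 => // -[].
have [z phiz] : exists z, forall g, G g -> g y = 0 -> phi g = g z.
  have [||||z phiz] := IHs (G `&` [set g | g y = 0]).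
  - by [].
  - move=> a u v [Gu uy] [Gv vy]; split; first exact: Glin.
    by have := dual_funP a u v y; rewrite uy vy mulr0 addr0.
  - by move=> a u v [Gu _] [Gv _]; exact: philin.
  - move=> g [Gg gy] gs; apply: phi0 => // i.
    by case: (unliftP ord0 i) => [j ->|-> //]; exact: gs.
  - by exists z => g Gg gy; exact: phiz.
have [[g0 Gg0 g0y]|noy] := pselect (exists2 g, G g & g y != 0); last first.
  exists z => g Gg; apply: phiz => //.
  by apply/eqP; apply: contrapT => /negP gy; apply: noy; exists g.
exists (z + ((phi g0 - g0 z) / g0 y) *: y) => g Gg.
(* This combination vanishes at [y], so [z] represents [phi] on it. *)
have Gh : G (- (g y / g0 y) *: g0 + g) by exact: Glin.
have := phiz _ Gh; rewrite philin// !dual_funP mulNr divfK// addNr => /(_ erefl).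
rewrite dual_applyD dual_applyZ => h.
apply: (addrI (- (g y / g0 y) * phi g0)); rewrite h.
by field.
Qed.

(** Continuity at 0 gives finitely many points such that [phi] is less than 1 in absolute value on
    the elements of [G] small at them; by scaling, [phi] is zero on those vanishing there. *)
Lemma eval_of_weakstar_continuous G phi :
  G 0 -> (forall a u v, G u -> G v -> G (a *: u + v)) ->
  (forall a u v, G u -> G v -> phi (a *: u + v) = a * phi u + phi v) ->
  {within G, continuous (phi : dual X -> R^o)} ->
  exists x, forall g, G g -> phi g = g x.
Proof.
move=> G0 Glin philin /subspace_continuousP/(_ 0 G0).
move=> /cvgrPdist_lt/(_ _ ltr01)/dual_nbhs[s [e [e0 se]]].
have phi0 : phi 0 = 0.
  by have := philin (-1) 0 0 G0 G0; rewrite scaler0 addr0 mulN1r addNr.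
apply: (@eval_of_common_kernel s) => // g Gg gs.
apply/eqP; apply: contraPT isT => phig _.
have Gg' : G ((phi g)^-1 *: g + 0) by exact: Glin.
have gs' (i : 'I_(size s)) :
    `|((phi g)^-1 *: g + 0 : dual X) s`_i - (0 : dual X) s`_i| < e.
  by rewrite dual_funP gs mulr0 !dual_fun0 addr0 subr0 normr0.
have : `|phi 0 - phi ((phi g)^-1 *: g + 0)| < 1 by exact: (se _ gs' Gg').
by rewrite philin// phi0 addr0 mulVf// sub0r normrN normr1 ltxx.
Qed.

(* The bipolar theorem: a linear combination of evaluations separating g0 from
   G `&` dual_ball is itself an evaluation, which the norming condition excludes. *)
Lemma norming_closed_ball G (c : R) (C : set (dual X)) :
  G 0 -> (forall a u v, G u -> G v -> G (a *: u + v)) -> 0 < c ->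
  (forall x : X, c * `|x| <= sup [set (g x : R) | g in G `&` dual_ball]) ->
  closed C -> G `&` dual_ball `<=` C -> forall g, dual_norm g <= c -> C g.
Proof.
move=> G0 Glin c0 Gc clC GC g0 g0c; apply: contrapT => Cg0.
have /dual_nbhs[s [e [e0 se]]] : nbhs g0 (~` C).
  by apply: open_nbhs_nbhs; split => //; exact: closed_openC.
(* Coordinates of [g - g0] at the points of [s]. They cannot all be below [e] in absolute value,
   since [g] lies in [C], which misses that neighbourhood of [g0]. *)
pose C' : set ('I_(size s) -> R) :=
  
  [set (fun i : 'I_(size s) => g s`_i - g0 s`_i : R) | g in G `&` dual_ball].
have [_ _ t [g [Gg Bg] <-] [h [Gh Bh] <-] t01|_ i [g [Gg Bg] <-]||
    a [delta d0 ad]] := @separate_from_origin _ _ C'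
      (\sum_(i < size s) (1 + c) * `|s`_i|) e _ _ e0.
- exists (t *: g + (1 - t) *: h).
    split; last exact: dual_ball_line.
    by apply: (Glin) => //; rewrite -[_ *: h]addr0; exact: Glin.
  by apply/funext => i; rewrite dual_funP dual_funZ /=; ring.
- rewrite (bigD1 i)//= -[leLHS]addr0 lerD ?sumr_ge0// => [|j _]; last first.
    by rewrite mulr_ge0// addr_ge0// ltW.
  rewrite (le_trans (ler_normB _ _))// mulrDl mul1r lerD//;
    first exact: (proj1 (dual_ballP g)).
  by rewrite (le_trans (ler_dual_norm _ _))// ler_wpM2r.
- move=> _ [g GBg <-]; apply: contrapT => /forallNP ge.
  by apply: (se g) (GC _ GBg) => i; have /negP := ge i; rewrite -ltNge.
pose x := \sum_i a i *: s`_i.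
have xE (g : dual X) : g x = \sum_i a i * g s`_i.
  by rewrite dual_apply_sum; apply: eq_bigr => i _; rewrite dual_applyZ.
have gx g : G g -> dual_ball g -> delta <= g x - g0 x.
  move=> Gg Bg; rewrite !xE -sumrB.
  under eq_bigr do rewrite -mulrBr.
  by apply: ad; exists g.
(* The supremum at [- x] is below [g0 (- x)], itself at most [c] times the norm of [x], against
   [Gc]. *)
have : sup [set (g (- x) : R) | g in G `&` dual_ball] <= g0 (- x) - delta.
  apply: ge_sup.
    exists ((0 : dual X) (- x)), 0 => //; split=> //.
    by apply/dual_ballP => y; rewrite dual_fun0 normr0.
  by move=> _ [g [Gg Bg] <-]; rewrite !dual_applyN; have := gx g Gg Bg; lra.
have := Gc (- x); have := ler_norm (g0 (- x)); have := ler_dual_norm g0 (- x).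
have := ler_wpM2r (normr_ge0 (- x)) g0c; lra.
Qed.

(** * Sequentially continuous functionals under property (E') *)

Section property_E'.
Hypothesis XE : property_E' X.
Variable phi : dual X -> R.
Hypothesis philin : forall a u v, phi (a *: u + v) = a * phi u + phi v.
Hypothesis phiseq : forall (u : nat -> dual X) (l : dual X),
  u @ \oo --> l -> phi (u n) @[n --> \oo] --> phi l.

Let phi0 : phi 0 = 0.
Proof. by have := philin (-1) 0 0; rewrite scaler0 addr0 mulN1r addNr. Qed.

Let phiZ a g : phi (a *: g) = a * phi g.
Proof. by rewrite -[a *: g]addr0 philin phi0 addr0. Qed.

(** The part of the ball where [phi] is at least [e] is weak*-closed by [XE] and misses 0, so a
    basic neighbourhood of 0 avoids it; symmetry of the ball gives the bound on [- phi]. *)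
Lemma small_on_ball_nbhs (e : R) : 0 < e ->
  exists (s : seq X) (delta : R), 0 < delta /\
    forall g, dual_ball g -> (forall i : 'I_(size s), `|g s`_i| < delta) ->
      `|phi g| < e.
Proof.
move=> e0; pose C : set (dual X) := dual_ball `&` [set g | e <= phi g].
have clC : closed C.
  apply: XE.
  - move=> u l Cu ul; split.
      by apply: dual_ball_seq_closed ul => n; have [] := Cu n.
    by apply: (cvgr_to_ge (phiseq ul)); apply: nearW => n; have [] := Cu n.
  - apply: convex_set_line => g h t [Bg eg] [Bh eh] t01.
    split; first exact: dual_ball_line.
    have /andP[t0] := t01; rewrite -subr_ge0 => t1; rewrite /= philin phiZ.
    have := ler_wpM2l t0 eg; have := ler_wpM2l t1 eh; lra.
  - by exists 1 => g [].
have /dual_nbhs[s [delta [d0 sd]]] : nbhs 0 (~` C).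
  apply: open_nbhs_nbhs; split; first exact: closed_openC.
  by move=> [_] /=; rewrite phi0 leNgt e0.
exists s, delta; split=> // g Bg gs.
have lt_e h : dual_ball h -> (forall i : 'I_(size s), `|h s`_i| < delta) -> phi h < e.
  move=> Bh hs; rewrite ltNge; apply/negP => eh.
  by apply: (sd h) => // i; rewrite dual_fun0 subr0.
rewrite ltr_norml (lt_e g Bg gs) andbT ltrNl -mulN1r -phiZ; apply: lt_e => [|i].
  by apply: le_trans (dual_normZ _ _) _; rewrite normrN1 mul1r.
by rewrite dual_funZ mulN1r normrN.
Qed.

(* Separates (e, 0, .., 0) from the image of dual_ball under phi and the
   evaluations at the points given by small_on_ball_nbhs. *)
Lemma eval_approx (e : R) : 0 < e ->
  exists x, forall g, dual_ball g -> `|phi g - (g x : R)| <= e.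
Proof.
move=> e0; have e20 : 0 < e / 2 by rewrite divr_gt0.
have [s [delta [d0 sd]]] := small_on_ball_nbhs e20.
pose S := \sum_(i < size s) `|s`_i|.
have S0 : 0 <= S by exact: sumr_ge0.
have sS (i : 'I_(size s)) : `|s`_i| <= S.
  by rewrite /S (bigD1 i)//= lerDl sumr_ge0.
(* Dividing an element of the ball by [K] makes its values on [s] smaller than [delta]; hence [phi]
   is bounded by [K * (e / 2)] on the ball, as separation requires a bounded set. *)
pose K := 1 + S / delta.
have K1 : 1 <= K by rewrite lerDl divr_ge0// ltW.
have K0 : 0 < K by exact: lt_le_trans K1.
have Ki0 : 0 <= K^-1 by rewrite invr_ge0 ltW.
have phiK g : dual_ball g -> `|phi g| <= K * (e / 2).
  move=> Bg; rewrite -ler_pdivrMl// -(ger0_norm Ki0) -normrM -phiZ.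
  apply/ltW/sd => [|i].
    rewrite /dual_ball/= (le_trans (dual_normZ _ _))// (ger0_norm Ki0).
    by rewrite ler_pdivrMl// mulr1 (le_trans Bg).
  rewrite dual_funZ normrM (ger0_norm Ki0) ltr_pdivrMl//
    (le_lt_trans (proj1 (dual_ballP g) Bg _))//.
  rewrite (le_lt_trans (sS i))// /K mulrDl mul1r divfK ?gt_eqF// ltrDr//.
(* When all values on [s] are below [delta], [phi g] is below [e / 2], so the first coordinate is at
   least [e / 2] in absolute value: the image of the ball stays away from the origin. *)
pose w g (i : 'I_1 + 'I_(size s)) : R := if i is inr j then g s`_j else phi g - e.
pose C : set ('I_1 + 'I_(size s) -> R) := [set w g | g in dual_ball].
have [_ _ t [g Bg <-] [h Bh <-] t01|_ i [g Bg <-]|||a [eta eta0 aw]] :=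
  @separate_from_origin _ _ C (K * (e / 2) + e + S) (Num.min (e / 2) delta).
- exists (t *: g + (1 - t) *: h); first exact: dual_ball_line.
  by apply/funext => -[i|i] //=; rewrite philin phiZ; ring.
- case: i => i /=.
    by rewrite (le_trans (ler_normB _ _))// (gtr0_norm e0) -[leLHS]addr0 !lerD// phiK.
  rewrite (le_trans (proj1 (dual_ballP g) Bg _))// -[leLHS]add0r lerD//.
  by rewrite addr_ge0 ?mulr_ge0// ltW.
- by rewrite lt_min e20.
- move=> _ [g Bg <-]; apply: contrapT => /forallNP ge.
  have gd (i : 'I_(size s)) : `|g s`_i| < delta.
    rewrite ltNge; apply/negP => di; apply: (ge (inr i)).
    by rewrite /= ge_min di orbT.
  apply: (ge (inl ord0)); rewrite /= ge_min; apply/orP; left.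
  have := sd g Bg gd; rewrite ltr_norml => /andP[_ ge2].
  by rewrite distrC ger0_norm; lra.
pose x := \sum_i a (inr i) *: s`_i; pose a0 := a (inl ord0).
have gx g : dual_ball g -> eta <= a0 * (phi g - e) + g x.
  move=> Bg; rewrite dual_apply_sum.
  have /aw : C (w g) by exists g.
  rewrite big_sumType/= big_ord1; move/le_trans; apply; rewrite lerD2l.
  by rewrite le_eqVlt; apply/orP; left; apply/eqP/eq_bigr => i _; rewrite dual_applyZ.
(* Separation is tested at the zero functional, whose only nonzero coordinate is [- e]. *)
have a00 : a0 < 0.
  have : dual_ball (0 : dual X).
    by apply/dual_ballP => y; rewrite dual_fun0 normr0.
  move=> /gx; rewrite phi0 dual_fun0 addr0 sub0r => h.
  rewrite -oppr_gt0 -(pmulr_lgt0 _ e0) mulNr -mulrN; exact: lt_le_trans h.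
(* Dividing the separating inequality by [- a0] bounds the difference on one side; applying this to
   the opposite of [g] bounds the other. *)
exists ((- a0)^-1 *: x) => g Bg.
have le_e h : dual_ball h -> phi h - (h ((- a0)^-1 *: x) : R) <= e.
  move=> Bh; rewrite dual_applyZ -(ler_pM2l (_ : 0 < - a0)) ?oppr_gt0//.
  rewrite mulrBr mulrA divff ?mul1r; last by rewrite oppr_eq0 lt_eqF.
  by have := gx h Bh; lra.
rewrite ler_norml le_e// andbT.
have Bg' : dual_ball (-1 *: g).
  by apply: le_trans (dual_normZ _ _) _; rewrite normrN1 mul1r.
by have := le_e _ Bg'; rewrite phiZ dual_funZ; lra.
Qed.

End property_E'.

End functional_representation.

(** Two good approximants of [phi] on the ball are close on its part in [G], hence in norm by the
    norming bound. The limit of a Cauchy sequence of them represents [phi] on the ball, then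
    everywhere by homogeneity. *)
Lemma seq_continuous_eval (R : realType) (X : completeNormedModType R)
    (G : set (dual X)) (c : R) (phi : dual X -> R) :
  property_E' X -> G 0 -> 0 < c ->
  (forall x : X, c * `|x| <= sup [set (g x : R) | g in G `&` dual_ball]) ->
  (forall a u v, phi (a *: u + v) = a * phi u + phi v) ->
  (forall (u : nat -> dual X) (l : dual X),
    u @ \oo --> l -> phi (u n) @[n --> \oo] --> phi l) ->
  exists x, forall g, phi g = g x.
Proof.
move=> XE G0 c0 Gc philin phiseq.
have /choice[x_ xP] (n : nat) : exists x, forall g, dual_ball g ->
    `|phi g - (g x : R)| <= n.+1%:R^-1.
  by apply: eval_approx => //; rewrite invr_gt0.
have dist n m : c * `|x_ n - x_ m| <= n.+1%:R^-1 + m.+1%:R^-1.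
  apply: (le_trans (Gc _)); apply: ge_sup.
    exists ((0 : dual X) (x_ n - x_ m)), 0 => //; split=> //.
    by apply/dual_ballP => y; rewrite dual_fun0 normr0.
  move=> _ [g [Gg Bg] <-]; rewrite dual_applyB.
  rewrite (le_trans (ler_norm _))// (le_trans (ler_distD (phi g) _ _))//.
  by apply: lerD; [rewrite distrC|]; exact: xP.
have /cvg_ex[l xl] : cvgn x_.
  apply: cauchy_cvg; apply: cauchy_exP => e e0.
  have ce : 0 < c * e / 2 by rewrite divr_gt0// mulr_gt0.
  have [N _ NP] := near_infty_natSinv_lt (PosNum ce).
  exists (x_ N), N => // n /= Nn.
  rewrite -ball_normE /= -(ltr_pM2l c0) (le_lt_trans (dist _ _))//.
  by rewrite [ltRHS]splitr ltrD//; [exact: NP N (leqnn N)|exact: NP n Nn].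
have phil g : dual_ball g -> phi g = g l.
  move=> Bg; apply: (@cvg_unique _ (@norm_hausdorff _ R^o) (g (x_ n) @[n --> \oo])).
    apply/cvgrPdist_lt => e e0.
    have [N _ NP] := near_infty_natSinv_lt (PosNum e0).
    by exists N => // n /= Nn; exact: le_lt_trans (xP n g Bg) (NP n Nn).
  by apply: continuous_cvg => //; exact: (dual_linear_continuous g).2.
(* The summand 1 keeps [K] positive when [g] is zero; the added 0 in [Bg] gives the form to which
   [philin] applies. *)
exists l => g; pose K := 1 + dual_norm g.
have K0 : 0 < K by rewrite ltr_wpDr// dual_norm_ge0.
have Bg : dual_ball (K^-1 *: g + 0).
  rewrite addr0 /dual_ball/= (le_trans (dual_normZ _ _))//.
  by rewrite gtr0_norm ?invr_gt0// ler_pdivrMl// mulr1 lerDr.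
have phi0 : phi 0 = 0.
  by have := philin (-1) 0 0; rewrite scaler0 addr0 mulN1r addNr.
have := phil _ Bg; rewrite philin phi0 dual_funP dual_fun0 !addr0.
by apply: mulfI; rewrite invr_eq0 gt_eqF.
Qed.

(** * Integrals of compositions with [f] as functions of the functional *)

Section scalar_integrals.
Context {R : realType} {d : measure_display} {T : measurableType d}.
Variable nu : probability T R.

(** Scaling by [c / K], with [K] a norm bound for the sequence, brings it into the region of
    domination, where Vitali's theorem applies. The radius [c] is 1 on the given subspace and the
    norming constant on the whole dual. *)
Lemma seq_continuous_Rintegral (X : completeNormedModType R)
    (G : set (dual X)) (beta : set T -> \bar R) (c : R) (f : T -> X)
    (A : set T) (u : nat -> dual X) (l : dual X) :
  uniform_modulus nu beta -> 0 < c -> (forall a g, G g -> G (a *: g)) ->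
  (forall g, G g -> dual_norm g <= c ->
     absolutely_dominated nu beta (fun w => g (f w))) ->
  measurable A -> (forall n, G (u n)) -> u @ \oo --> l ->
  \int[nu]_(w in A) (u n (f w)) @[n --> \oo] --> \int[nu]_(w in A) (l (f w)).
Proof.
move=> mb c0 GZ Gb mA Gu ul; have [K K0 uK] := dual_cvgn_bounded ul.
move: ul => /dual_cvgnP ul.
pose a := c / K; have a0 : 0 < a by rewrite divr_gt0.
have ub n : absolutely_dominated nu beta (fun w => a * u n (f w)).
  apply: (Gb (a *: u n)); first exact: GZ.
  rewrite (le_trans (dual_normZ _ _))// gtr0_norm//.
  by rewrite /a -mulrA ger_pMr// ler_pdivrMl// mulr1.
have ual w : a * u n (f w) @[n --> \oo] --> a * l (f w).
  by apply: cvgMr; exact: ul.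
(* The limit inherits domination from the sequence, not from membership in [G]. *)
have lb := absolutely_dominated_cvg ub ual.
have aK h : absolutely_dominated nu beta (fun w => a * h w) ->
    \int[nu]_(w in A) h w = a^-1 * \int[nu]_(w in A) (a * h w).
  move=> hb; rewrite -RintegralZl//.
    by apply: eq_Rintegral => w _; rewrite mulKf// gt_eqF.
  exact: absolutely_dominated_integrable mb hb mA.
rewrite (aK _ lb) [X in X @ _ --> _](_ : _ = fun n =>
    a^-1 * \int[nu]_(w in A) (a * u n (f w))); last first.
  by apply/funext => n; exact: aK (ub n).
by apply: cvgMr; exact: (absolutely_dominated_cvg_Rintegral mb ub).
Qed.

Lemma Rintegral_dual_linear (X : normedModType R) (f : T -> X) (A : set T)
    (a : R) (u v : dual X) : measurable A ->
  nu.-integrable setT (fun w => (u (f w))%:E) ->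
  nu.-integrable setT (fun w => (v (f w))%:E) ->
  \int[nu]_(w in A) ((a *: u + v : dual X) (f w)) =
  a * \int[nu]_(w in A) (u (f w)) + \int[nu]_(w in A) (v (f w)).
Proof.
move=> mA iu iv.
have iuA : nu.-integrable A (EFin \o (fun w => u (f w))).
  exact: (@integrableS _ _ _ _ setT).
have ivA : nu.-integrable A (EFin \o (fun w => v (f w))).
  exact: (@integrableS _ _ _ _ setT).
by rewrite -RintegralZl// -RintegralD//; exact: (integrableZl mA a iuA).
Qed.

End scalar_integrals.

(** * Integrability over the subspace and Pettis integrability *)

Unset Implicit Arguments.

Theorem theorem3p7 (R : realType) (d : measure_display) (T : measurableType d)
    (nu : probability T R) (nu_complete : measure_is_complete nu)
    (X : completeNormedModType R) (G : set (dual X))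
    (G_subspace : submod_closed [in G]) (G_total : total_set G)
    (f : T -> X) (f_int : scalarly_integrable nu G f)
    (f_ui : uniformly_integrable nu
      [set (fun w => g (f w)) | g in G `&` dual_ball]) :
  (mazur_property G -> gamma_integrable nu G f) /\
  (property_E' X -> norming G -> pettis_integrable nu f).
Proof.
have G0 : G 0 by have [+ _] := G_subspace; rewrite inE.
have Glin a u v : G u -> G v -> G (a *: u + v).
  have [_ +] := G_subspace => /(_ a u v); rewrite !inE => h Gu Gv; exact: h.
have GZ a g : G g -> G (a *: g) by move=> Gg; rewrite -[a *: g]addr0; exact: Glin.
case: f_ui => Hint [M HM] Hac.
(* This records the uniform integrability of the family over [G] as bounds that functionals outside
   [G] can satisfy too. *)
pose beta (A : set T) := ereal_sup [set (\int[nu]_(w in A) `|h w|%:E)%E |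
  h in [set (fun w => (g (f w) : R)) | g in G `&` dual_ball]].
have mb : uniform_modulus nu beta.
  split=> [|e e0]; last exact: Hac.
  apply: (@le_lt_trans _ _ M%:E); rewrite ?ltry//.
  by apply: ge_ereal_sup => _ [h Hh <-]; exact: HM.
have Gb g : G g -> dual_norm g <= 1 ->
    absolutely_dominated nu beta (fun w => g (f w)).
  move=> Gg Bg; split=> [|A mA].
    exact/measurable_EFinP/(measurable_int nu (f_int g Gg)).
  by apply: ereal_sup_ubound; exists (fun w => g (f w)) => //; exists g.
split=> [mazur|XE [_ [c [C [c0 _ cG]]]]].
  split=> // A mA.
  pose phi (g : dual X) : R := \int[nu]_(w in A) (g (f w)).
  have philin a u v : G u -> G v -> phi (a *: u + v) = a * phi u + phi v.
    by move=> Gu Gv; apply: Rintegral_dual_linear => //; exact: f_int.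
  have [||||x xP] := @eval_of_weakstar_continuous _ _ G phi => //.
    apply: mazur => [a u v|u l Gu _ ul]; first by rewrite !inE; exact: philin.
    exact: (seq_continuous_Rintegral mb ltr01 GZ Gb mA Gu ul).
  exists x => g Gg; rewrite -(xP g Gg) fineK//.
  apply: integrable_fin_num => //.
  exact: (@integrableS _ _ _ _ setT _ _ _ _ _ (f_int g Gg)).
have Gc (x : X) : c * `|x| <= sup [set (g x : R) | g in G `&` dual_ball].
  by have /andP[] := cG x.
(* [Z] contains the part of the ball in [G]; once it is weak*-closed, the norming constant [c]
   forces it to contain the whole ball of radius [c]. *)
pose Z : set (dual X) :=
  dual_ball `&` [set g | absolutely_dominated nu beta (fun w => g (f w))].
have clZ : closed Z.
  apply: XE.
  - move=> u l Zu ul; split.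
      by apply: dual_ball_seq_closed ul => n; have [] := Zu n.
    apply: (@absolutely_dominated_cvg _ _ _ nu beta (fun n w => u n (f w))).
      by move=> n; have [] := Zu n.
    by move=> w; move: ul => /dual_cvgnP; exact.
  - apply: convex_set_line => g h t [Bg bg] [Bh bh] t01.
    by split; [exact: dual_ball_line|exact: absolutely_dominated_convex].
  - by exists 1 => g [].
have Zb g : setT g -> dual_norm g <= c ->
    absolutely_dominated nu beta (fun w => g (f w)).
  move=> _ gc; suff [] : Z g by [].
  apply: (norming_closed_ball G0 Glin c0 Gc clZ _ gc) => h [Gh Bh].
  by split=> //; exact: Gb.
(* Scaling by [c / K] puts any [g] in the ball of radius [c], where [Zb] gives integrability; the
   factor [K / c] undoes it. *)
have int_dual : scalarly_integrable nu setT f.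
  move=> g _; pose K := 1 + dual_norm g.
  have K0 : 0 < K by rewrite ltr_wpDr// dual_norm_ge0.
  have hb : absolutely_dominated nu beta (fun w => (c / K) * g (f w)).
    apply: (Zb (c / K *: g)) => //; rewrite (le_trans (dual_normZ _ _))//.
    rewrite gtr0_norm ?divr_gt0// -mulrA ger_pMr// ler_pdivrMl// mulr1.
    by rewrite /K lerDr.
  have := integrableZl measurableT (K / c)
    (absolutely_dominated_integrable mb hb measurableT).
  apply: eq_integrable => // w _ /=; rewrite -EFinM; congr EFin.
  by rewrite mulrA -invf_div mulVf ?mul1r// mulf_neq0 ?invr_eq0 ?gt_eqF.
split=> // A mA.
have [||x xP] := @seq_continuous_eval _ X G c
  (fun g => \int[nu]_(w in A) (g (f w))) XE G0 c0 Gc.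
- by move=> a u v; apply: Rintegral_dual_linear => //; exact: int_dual.
- move=> u l ul; exact: (seq_continuous_Rintegral mb c0 _ Zb mA _ ul).
exists x => g Gg; rewrite -(xP g) fineK//.
apply: integrable_fin_num => //.
exact: (@integrableS _ _ _ _ setT _ _ _ _ _ (int_dual g Gg)).
Qed.
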